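(* Let $T$ be a power-bounded linear operator on a complex Banach space $X$, and assume that $\lambda_1,\dots,\lambda_k \in \mathbb T$ are such that each $\bar\lambda_j T$, $1\le j\le k$, is mean ergodic (e.g. $X$ is reflexive). If for every $x \in X_0:=\overline{ \big[\prod_{j=1}^k (\lambda_jI-T) \big]X}$ the series $\sum_{n=1}^\infty \frac{\lambda^n T^n x}{n}$ converges in norm for every $\lambda \in \mathbb T$, then $T$ is rotationally uniformly ergodic, with $\sigma(T)\cap \mathbb T \subset\{\lambda_1,\dots,\lambda_k\}$.
   Context: $\mathbb T$ is the unit circle in $\mathbb C$; $\sigma(T)$ is the spectrum of $T$. $T$ is power-bounded if $\sup_n\|T^n\|<\infty$. A bounded operator $S$ is mean ergodic if $\frac1n\sum_{k=1}^nS^k$ converges in the strong operator topology, and uniformly ergodic if these averages converge in operator norm. $T$ is rotationally uniformly ergodic if $\lambda T$ is uniformly ergodic for every $\lambda\in\mathbb T$. *)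

(* Defs.v *)
From mathcomp Require Export all_boot all_order all_algebra.
From mathcomp Require Export complex.
From mathcomp Require Export boolp classical_sets functions reals topology.
From mathcomp Require Export normedtype sequences.

Set Implicit Arguments.
Unset Strict Implicit.
Unset Printing Implicit Defensive.

Import Order.TTheory GRing.Theory Num.Theory.
Import numFieldNormedType.Exports.

Local Open Scope classical_set_scope.
Local Open Scope ring_scope.

(* A complex Banach space is X : completeNormedModType R[i] with R : realType.
   The norm of such an X takes its values in R[i] (they are nonnegative, hence
   real); [Re] transports them to R. *)

Definition unit_circle (R : realType) : set R[i] := [set z | `|z| = 1].

Section operators.
Context {R : realType} {X : completeNormedModType R[i]}.
Implicit Types (S T : X -> X) (mu : R[i]).

Definition bounded_operator T :=
  linear T /\ exists M : R, forall x, complex.Re `|T x| <= M * complex.Re `|x|.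

(* [sup] is the supremum only for nonempty sets bounded above, and 0 otherwise,
   so [opnorm T] is the operator norm of T only when T is a bounded operator. *)
Definition opnorm T : R := sup [set complex.Re `|T x| | x in [set x | `|x| <= 1]].

Definition power_bounded T :=
  bounded_operator T /\ exists M : R, forall n, opnorm (iter n T) <= M.

Definition ergodic_average S (n : nat) : X -> X :=
  fun x => n%:R^-1 *: \sum_(1 <= k < n.+1) iter k S x.

Definition mean_ergodic S :=
  exists2 P : X -> X, bounded_operator P &
    forall x, ergodic_average S n x @[n --> \oo] --> P x.

Definition uniformly_ergodic S :=
  exists2 P : X -> X, bounded_operator P &
    opnorm (ergodic_average S n \- P) @[n --> \oo] --> (0 : R).

Definition rotationally_uniformly_ergodic T :=
  forall lambda : R[i], unit_circle lambda ->
    uniformly_ergodic (lambda \*: T).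

Definition invertible_operator S :=
  exists2 V : X -> X, bounded_operator V & cancel S V /\ cancel V S.

Definition spectrum T : set R[i] :=
  [set mu | ~ invertible_operator (mu \*: idfun \- T)].

End operators.

(* Main.v *)
From HB Require Import structures.
Require Import Defs.
From mathcomp Require Import ring lra.

Set Implicit Arguments.
Unset Strict Implicit.
Unset Printing Implicit Defensive.

Import Order.TTheory GRing.Theory Num.Theory.
Import numFieldNormedType.Exports.

Local Open Scope classical_set_scope.
Local Open Scope ring_scope.

(** Write S = lambda T for a rotation of T, A_n = (S + ... + S^n) / n, and P_j
    for the strong limit of the averages of conj(lambda_j) T, which is a
    bounded projection onto the eigenspace of T for lambda_j.  Put

      E = (I - P_1) ... (I - P_k).

    As I - P_j is a strong limit of operators (lambda_j - T) B with B a
    polynomial in T, E maps X into X_0, and E is an idempotent commuting with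
    T (lemma [ergodic_complement_exists]).  Expanding the product, I - E is a
    sum of operators P_j E_j, with E_j a partial product, whose range consists
    of eigenvectors of T for lambda_j.  On such eigenvectors S acts as a scalar, so everything is decided
    by the behaviour of I - S on the range of E.

    There the hypothesis enters.  The partial sums
    H_N E = sum_(n <= N) S^n E / n converge pointwise, hence are bounded by
    some K uniformly in N ([uniform_boundedness]).  If y = E y is almost fixed
    by S, then S^n y is close to y for all n <= N, hence H_N y is close to
    (1 + 1/2 + ... + 1/N) y, and the divergence of the harmonic series forces y
    to be small: |y| <= C |y - S y| ([bounded_below_of_log_series]).  An
    operator bounded below need not be onto, but averaging provides approximate
    solutions of (I - S) y = E x: there are B_n with
    (I - S) B_n = I - A_n, and A_n E tends to 0 since (I - S) A_n = O(1/n)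
    and I - S is bounded below.  The lower bound makes B_n E x a Cauchy
    sequence, so (I - S) V = E for some bounded V commuting with T
    ([coboundary_operator]).

    Altogether I = F + (I - S) W with S F = F and F, W bounded
    ([rotation_coboundary_id]).  Then A_n - F = A_n (I - S) W = O(1/n) in
    operator norm, which is uniform ergodicity of S.  If conj(lambda) is none
    of the lambda_j then no P_j contributes to F, so F = 0 and W inverts I - S,
    which means that conj(lambda) is outside the spectrum of T. *)

(** * The norm as a real-valued function *)

(** Estimates are carried out in R, where the order is total, instead of R[i]. *)
Definition nrm (R : realType) (X : normedModType R[i]) (x : X) : R :=
  complex.Re `|x|.

Lemma gtc0_Re (R : realType) (e : R[i]) : 0 < e ->
  e = (complex.Re e)%:C%C /\ 0 < complex.Re e.
Proof.
move=> e0; split; first by rewrite RRe_real // gtr0_real.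
by move: e0; rewrite ltcE /= => /andP[].
Qed.

Section real_norm.
Context {R : realType} {X : normedModType R[i]}.
Implicit Types (x y : X) (u : nat -> X).

Lemma norm_nrm x : `|x| = (nrm x)%:C%C.
Proof. by rewrite /nrm RRe_real // ger0_real. Qed.

Lemma nrm_ge0 x : 0 <= nrm x.
Proof. by rewrite -lecR -norm_nrm; exact: normr_ge0. Qed.

Lemma nrm0 : nrm (0 : X) = 0.
Proof. by rewrite /nrm normr0. Qed.

Lemma nrm_eq0 x : nrm x = 0 -> x = 0.
Proof. by move=> h; apply/eqP; rewrite -normr_eq0 norm_nrm h. Qed.

Lemma ler_nrmD x y : nrm (x + y) <= nrm x + nrm y.
Proof. by rewrite -lecR rmorphD /= -!norm_nrm ler_normD. Qed.

Lemma nrmN x : nrm (- x) = nrm x.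
Proof. by rewrite /nrm normrN. Qed.

Lemma nrm_distrC x y : nrm (x - y) = nrm (y - x).
Proof. by rewrite /nrm distrC. Qed.

Lemma ler_nrmB x y : nrm (x - y) <= nrm x + nrm y.
Proof. by rewrite (le_trans (ler_nrmD _ _)) // nrmN. Qed.

Lemma nrm_triangle x y z : nrm (x - z) <= nrm (x - y) + nrm (y - z).
Proof. by rewrite (le_trans _ (ler_nrmD _ _)) // addrA subrK. Qed.

Lemma nrm_sum_le (I : Type) (s : seq I) (P : pred I) (f : I -> X) :
  nrm (\sum_(i <- s | P i) f i) <= \sum_(i <- s | P i) nrm (f i).
Proof.
elim/big_ind2 : _ => [|x1 x2 y1 y2 h1 h2|//]; first by rewrite nrm0.
by rewrite (le_trans (ler_nrmD _ _)) // lerD.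
Qed.

Lemma nrmZ (a : R[i]) x : nrm (a *: x) = complex.Re `|a| * nrm x.
Proof.
apply: complexI; rewrite -norm_nrm normrZ norm_nrm rmorphM /=.
by rewrite RRe_real // ger0_real.
Qed.

Lemma nrmZ_circle (a : R[i]) x : unit_circle a -> nrm (a *: x) = nrm x.
Proof. by move=> a1; rewrite nrmZ a1 mul1r. Qed.

Lemma nrmZ_nat_inv n x : nrm (n%:R^-1 *: x) = n%:R^-1 * nrm x.
Proof.
rewrite nrmZ; congr (_ * _); rewrite ger0_norm ?invr_ge0 ?ler0n //.
by rewrite -(rmorph_nat (real_complex R)) -fmorphV.
Qed.

Lemma nrmZ_real (a : R) x : nrm (a%:C%C *: x) = `|a| * nrm x.
Proof.
by rewrite nrmZ; congr (_ * _); rewrite normc_def /= expr0n addr0 sqrtr_sqr.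
Qed.

Lemma cvg_nrmP u (l : X) :
  u n @[n --> \oo] --> l <->
  forall e : R, 0 < e -> exists N, forall n, (N <= n)%N -> nrm (u n - l) < e.
Proof.
split=> [/cvgrPdist_lt ul e e0|ul].
  have e0' : 0 < e%:C%C by rewrite ltcE /= eqxx.
  have [N _ uN] := ul _ e0'.
  by exists N => n /uN /=; rewrite distrC norm_nrm ltcR.
apply/cvgrPdist_lt => e e0.
have [eE {}e0] := gtc0_Re e0.
have [N uN] := ul _ e0.
by exists N => // n /uN /=; rewrite eE distrC norm_nrm ltcR.
Qed.

Lemma cvg_nrm_unique u (l l' : X) : u n @[n --> \oo] --> l -> u n @[n --> \oo] --> l' ->
  l = l'.
Proof. by apply: cvg_unique; exact: norm_hausdorff. Qed.

Lemma cvgn_nrm_bounded u : cvgn u -> exists K : R, forall n, nrm (u n) <= K.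
Proof.
move=> /cvg_ex[l /cvg_nrmP /(_ 1 ltr01)[N uN]].
exists (\sum_(i < N) nrm (u i) + (nrm l + 1)) => n.
have [/uN/ltW ul|nN] := leqP N n.
  rewrite (le_trans _ (_ : nrm l + 1 <= _)) ?lerDr ?sumr_ge0//; last first.
    by move=> i _; exact: nrm_ge0.
  by rewrite -[u n](subrK l) (le_trans (ler_nrmD _ _))// addrC lerD2l.
rewrite (bigD1 (Ordinal nN)) //= -addrA lerDl.
rewrite !addr_ge0 ?nrm_ge0 ?ler01 // sumr_ge0 // => i _; exact: nrm_ge0.
Qed.

Lemma closure_nrmP (A : set X) x :
  closure A x <-> forall e : R, 0 < e -> exists2 y, A y & nrm (x - y) < e.
Proof.
split=> [Ax e e0|Ax].
  have e0' : 0 < e%:C%C by rewrite ltcE /= eqxx.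
  have [y [Ay]] := Ax (ball x e%:C%C) (nbhsx_ballx x _ e0').
  by rewrite -ball_normE /= norm_nrm ltcR; exists y.
move=> B /nbhs_ballP [e /= e0 eB].
have [eE {}e0] := gtc0_Re e0.
have [y Ay xy] := Ax _ e0; exists y; split=> //; apply: eB.
by rewrite -ball_normE /= eE norm_nrm ltcR.
Qed.

End real_norm.

Lemma cauchy_nrm_cvg (R : realType) (X : completeNormedModType R[i])
    (u : nat -> X) :
  (forall e : R, 0 < e -> exists N, forall n, (N <= n)%N -> nrm (u n - u N) < e) ->
  exists l : X, u n @[n --> \oo] --> l.
Proof.
move=> uC; suff: cvgn u by move=> /cvg_ex.
apply: cauchy_cvg; apply: cauchy_exP => e e0.
have [eE {}e0] := gtc0_Re e0.
have [N uN] := uC _ e0; exists (u N); exists N => // n /uN /=.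
by rewrite -ball_normE /= eE distrC norm_nrm ltcR.
Qed.

(** * Bounded operators and the operator norm *)
Section operators.
Context {R : realType} {X : completeNormedModType R[i]}.
Implicit Types (A B D S T : X -> X).

(** Trades the propositional linearity of a bounded operator for a structure,
    to which the generic lemmas on linear maps apply. *)
Lemma bounded_operatorP A : bounded_operator A ->
  exists2 F : {linear X -> X}, A = F & exists2 M, 0 < M & forall x, nrm (F x) <= M * nrm x.
Proof.
move=> [Al [M AM]].
pose H := GRing.isLinear.Build R[i] X X _ A Al.
pose F : {linear X -> X} := HB.pack A H.
exists F => //; exists (`|M| + 1) => [|x]; first by rewrite ltr_wpDl.
rewrite (le_trans (AM x)) // ler_wpM2r ?nrm_ge0 //.
by rewrite (le_trans (ler_norm M)) // lerDl.
Qed.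

Lemma bounded_operatorI (A : {linear X -> X}) (M : R) :
  (forall x, nrm (A x) <= M * nrm x) -> bounded_operator A.
Proof. by move=> AM; split; [exact: linearP|exists M]. Qed.

Lemma bounded_id : bounded_operator (@idfun X).
Proof. by apply: (@bounded_operatorI idfun 1) => x; rewrite mul1r. Qed.

Lemma bounded_comp A B :
  bounded_operator A -> bounded_operator B -> bounded_operator (A \o B).
Proof.
move=> /bounded_operatorP[F -> [a a0 Fa]] /bounded_operatorP[G -> [b b0 Gb]].
apply: (@bounded_operatorI (F \o G) (a * b)) => x /=.
by rewrite (le_trans (Fa _)) // -mulrA ler_wpM2l // ltW.
Qed.

Lemma bounded_add A B :
  bounded_operator A -> bounded_operator B -> bounded_operator (A \+ B).
Proof.
move=> /bounded_operatorP[F -> [a a0 Fa]] /bounded_operatorP[G -> [b b0 Gb]].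
apply: (@bounded_operatorI (F \+ G) (a + b)) => x /=.
by rewrite (le_trans (ler_nrmD _ _)) // mulrDl lerD.
Qed.

Lemma bounded_scale (a : R[i]) A :
  bounded_operator A -> bounded_operator (a \*: A).
Proof.
move=> /bounded_operatorP[F -> [M M0 FM]].
apply: (@bounded_operatorI (a \*: F) (complex.Re `|a| * M)) => x /=.
by rewrite nrmZ -mulrA ler_wpM2l //; exact: (@nrm_ge0 R R[i]^o a).
Qed.

Lemma bounded_sub A B :
  bounded_operator A -> bounded_operator B -> bounded_operator (A \- B).
Proof.
move=> Ab Bb; rewrite (_ : A \- B = A \+ (-1 \*: B)).
  by apply: bounded_add => //; exact: bounded_scale.
by apply: funext => x /=; rewrite scaleN1r.
Qed.

Lemma bounded_0 : bounded_operator (fun=> 0 : X).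
Proof. by apply: (@bounded_operatorI (\0) 0) => x; rewrite nrm0 mul0r. Qed.

Lemma bounded_cvg A (u : nat -> X) (l : X) : bounded_operator A ->
  u n @[n --> \oo] --> l -> A (u n) @[n --> \oo] --> A l.
Proof.
move=> /bounded_operatorP[F -> [M M0 FM]] /cvg_nrmP ul.
apply/cvg_nrmP => e e0.
have /ul[N uN] : 0 < e / M by rewrite divr_gt0.
exists N => n /uN; rewrite ltr_pdivlMr // mulrC -linearB => h.
exact: le_lt_trans (FM _) h.
Qed.

Lemma opnorm_ge0 A (C : R) : (forall x, nrm (A x) <= C * nrm x) -> 0 <= opnorm A.
Proof.
move=> AC; apply: (@le_trans _ _ (nrm (A 0))); first exact: nrm_ge0.
apply: ub_le_sup; last by exists 0 => //=; rewrite normr0 ler01.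
exists `|C| => _ [x /= x1 <-].
rewrite norm_nrm lecR in x1.
rewrite (le_trans (AC x)) // (le_trans (ler_wpM2r (nrm_ge0 _) (ler_norm C))) //.
by rewrite ler_piMr.
Qed.

Lemma opnorm_le A (C : R) : 0 <= C -> (forall x, nrm (A x) <= C * nrm x) ->
  opnorm A <= C.
Proof.
move=> C0 AC; apply: ge_sup; first by exists (nrm (A 0)); exists 0 => //=; rewrite normr0 ler01.
move=> _ [x /= x1 <-]; rewrite norm_nrm lecR in x1.
by rewrite (le_trans (AC x)) // ler_piMr.
Qed.

Lemma le_opnorm A x : bounded_operator A -> nrm (A x) <= opnorm A * nrm x.
Proof.
move=> /bounded_operatorP[F -> [M M0 FM]].
have [x0|x0] := eqVneq (nrm x) 0.
  by rewrite (nrm_eq0 x0) linear0 nrm0 mulr0.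
have {}x0 : 0 < nrm x by rewrite lt_def x0 nrm_ge0.
rewrite -ler_pdivrMr //; apply: ub_le_sup.
  exists M => _ [y /= y1 <-]; rewrite norm_nrm lecR in y1.
  by rewrite (le_trans (FM y)) // ler_piMr // ltW.
exists ((nrm x)^-1%:C%C *: x) => /=.
  by rewrite norm_nrm nrmZ_real ger0_norm ?invr_ge0 ?nrm_ge0 // mulVf // gt_eqF.
rewrite -[LHS]/(nrm _) linearZ nrmZ_real ger0_norm ?invr_ge0 ?nrm_ge0 //.
by rewrite mulrC.
Qed.

Lemma bounded_iter T n : bounded_operator T -> bounded_operator (iter n T).
Proof.
move=> Tb; elim: n => [|n IH]; first exact: bounded_id.
by rewrite (_ : iter n.+1 T = T \o iter n T) //; exact: bounded_comp.
Qed.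

(** The bound is made positive so that it can be divided by. *)
Lemma power_boundedP T : power_bounded T ->
  exists2 M : R, 0 < M & forall n x, nrm (iter n T x) <= M * nrm x.
Proof.
move=> [Tb [M TM]]; exists (`|M| + 1) => [|n x]; first by rewrite ltr_wpDl.
rewrite (le_trans (le_opnorm x (bounded_iter n Tb))) // ler_wpM2r ?nrm_ge0 //.
by rewrite (le_trans (TM n)) // (le_trans (ler_norm M)) // lerDl.
Qed.

End operators.

(** * The uniform boundedness principle *)
Lemma cvg_nrm_le (R : realType) (X : normedModType R[i]) (u : nat -> X)
    (l a : X) (c : R) (N : nat) :
  u n @[n --> \oo] --> l -> (forall n, (N <= n)%N -> nrm (u n - a) <= c) ->
  nrm (l - a) <= c.
Proof.
move=> /cvg_nrmP ul uc; apply/ler_addgt0Pr => e /ul[N' uN'].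
have := uN' _ (leq_maxr N N'); have := uc _ (leq_maxl N N').
set n := maxn N N' => h1 h2.
rewrite (le_trans (nrm_triangle l (u n) a)) // addrC lerD // nrm_distrC.
exact: ltW.
Qed.

Lemma cvg_nrm_inv (R : realType) (X : normedModType R[i]) (u : nat -> X)
    (l : X) (c : R) :
  (forall n, (0 < n)%N -> nrm (u n - l) <= n%:R^-1 * c) ->
  u n @[n --> \oo] --> l.
Proof.
move=> uc; apply/cvg_nrmP => e e0.
exists (Num.truncn (`|c| / e)).+1 => n hn.
have n0 : (0 < n)%N by exact: leq_trans hn.
rewrite (le_lt_trans (uc _ n0)) // mulrC ltr_pdivrMr ?ltr0n //.
rewrite (le_lt_trans (ler_norm c)) // mulrC -ltr_pdivrMr //.
by rewrite (lt_le_trans (truncnS_gt _)) // ler_nat.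
Qed.

Section uniform_boundedness.
Context {R : realType} {X : completeNormedModType R[i]}.
Variable L : nat -> X -> X.
Hypothesis L_bounded : forall N, bounded_operator (L N).

(** A bound on a single ball of radius r and any centre x would bound all of
    the operators: 2 L h = L (x + h) - L (x - h). *)
Let not_locally_bounded :
  (~ exists K : R, forall N x, nrm (L N x) <= K * nrm x) ->
  forall (x : X) (r c : R), 0 < r ->
  exists N, exists2 z, nrm (z - x) <= r & c < nrm (L N z).
Proof.
move=> unbounded x r c r0; apply: contrapT => bounded; apply: unbounded.
have Lc N z : nrm (z - x) <= r -> nrm (L N z) <= c.
  move=> zx; rewrite leNgt; apply/negP => cz.
  by apply: bounded; exists N; exists z.
exists (c / r) => N y; have [F FE _] := bounded_operatorP (L_bounded N).
have [y0|y0] := eqVneq (nrm y) 0.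
  by rewrite (nrm_eq0 y0) FE linear0 nrm0 mulr0.
have {}y0 : 0 < nrm y by rewrite lt_def y0 nrm_ge0.
have ry : 0 < r / nrm y by exact: divr_gt0.
pose h : X := (r / nrm y)%:C%C *: y.
have hr : nrm h = r.
  by rewrite nrmZ_real gtr0_norm // divfK // gt_eqF.
have Lh : nrm (L N h) <= c.
  have : nrm (L N (x + h) - L N (x - h)) <= c + c.
    by rewrite (le_trans (ler_nrmB _ _)) // lerD // Lc // addrAC subrr add0r ?nrmN hr.
  rewrite FE -linearB opprD addrACA subrr add0r opprK.
  have -> : h + h = (2 : R)%:C%C *: h.
    by rewrite rmorph_nat scaler_nat mulr2n.
  by rewrite linearZ nrmZ_real ger0_norm //; lra.
rewrite -(ler_pM2l ry); move: Lh; rewrite /h FE linearZ nrmZ_real gtr0_norm //.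
suff -> : r / nrm y * (c / r * nrm y) = c by [].
by field; rewrite !gt_eqF.
Qed.

(** Nested balls: if the norms are unbounded, each ball contains a smaller one
    on which some L N exceeds a prescribed value, and the common point of the
    balls contradicts pointwise boundedness. *)
Theorem uniform_boundedness :
  (forall x, exists K : R, forall N, nrm (L N x) <= K) ->
  exists K : R, forall N x, nrm (L N x) <= K * nrm x.
Proof.
move=> pointwise; apply: contrapT => /not_locally_bounded nlb.
have step (np : nat * (X * R)) : exists q : X * R, 0 < np.2.2 ->
    [/\ 0 < q.2, q.2 <= np.2.2 / 2, nrm (q.1 - np.2.1) <= np.2.2 / 2 &
        exists N, forall z, nrm (z - q.1) <= q.2 -> np.1%:R <= nrm (L N z)].
  case: np => n [x r] /=; have [r0|r0] := ltP 0 r; last first.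
    by exists (x, r); rewrite ltNge r0.
  have r20 : 0 < r / 2 by rewrite divr_gt0.
  have [N [z zx Lz]] := nlb x (r / 2) n%:R r20.
  have [F FE [M M0 FM]] := bounded_operatorP (L_bounded N).
  (* L N is Lipschitz with constant M: within this radius of z its norm loses
     at most the margin by which it exceeds n at z. *)
  exists (z, Num.min (r / 2) ((nrm (L N z) - n%:R) / M)) => _ /=.
  split=> //; first by rewrite lt_min r20 divr_gt0 // subr_gt0.
    by rewrite ge_min lexx.
  exists N => y; rewrite le_min => /andP[_]; rewrite ler_pdivlMr // mulrC => yz.
  have := ler_nrmD (F y) (F (z - y)); rewrite -linearD addrC subrK.
  have := FM (z - y); rewrite nrm_distrC.
  by move: yz; rewrite FE; lra.
have [f fP] := choice step.
pose s := fix s n := if n is m.+1 then f (m, s m) else (0, 1) : X * R.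
have s0 n : 0 < (s n).2.
  by elim: n => [|n IH] //=; have [] := fP (n, s n) IH.
have sr n : (s n).2 <= n.+1%:R^-1.
  elim: n => [|n IH]; first by rewrite invr1.
  have [_ /le_trans h _ _] := fP (n, s n) (s0 n); apply: h => /=.
  rewrite (le_trans (ler_wpM2r _ IH)) ?invr_ge0 // -invfM lef_pV2 ?posrE ?ltr0n//.
    by rewrite -natrM ler_nat muln2 -addnn addnS ltnS leq_addr.
  by rewrite mulr_gt0.
have nested n z : nrm (z - (s n.+1).1) <= (s n.+1).2 -> nrm (z - (s n).1) <= (s n).2.
  have [_ /= h1 h2 _] := fP (n, s n) (s0 n).
  have := nrm_triangle z (s n.+1).1 (s n).1 => /=.
  by move: h1 h2; lra.
have nestedD k n z : nrm (z - (s (n + k)%N).1) <= (s (n + k)%N).2 ->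
    nrm (z - (s n).1) <= (s n).2.
  by elim: k => [|k IH]; rewrite ?addn0 // addnS => /nested.
have sn n m : (n <= m)%N -> nrm ((s m).1 - (s n).1) <= (s n).2.
  by move=> nm; apply: (nestedD (m - n)%N); rewrite subnKC // subrr nrm0 ltW.
have [|x sx] := @cauchy_nrm_cvg _ _ (fun n => (s n).1).
  move=> e e0; exists (Num.truncn e^-1) => n /sn /le_lt_trans; apply.
  rewrite (le_lt_trans (sr _)) // -[ltRHS]invrK ltf_pV2 ?posrE ?invr_gt0 //.
  by rewrite truncnS_gt.
have xs n : nrm (x - (s n).1) <= (s n).2 by exact: cvg_nrm_le sx (sn n).
have [K LK] := pointwise x.
set m := (Num.truncn K).+1.
have [_ _ _ [N LN]] := fP (m, s m) (s0 m).
have := le_trans (LN x (xs m.+1)) (LK N).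
by rewrite leNgt truncnS_gt.
Qed.

End uniform_boundedness.

(** * Averages of a power-bounded operator and the logarithm series *)

Lemma harmonic_unbounded (R : realType) (K : R) : exists N : nat,
  K <= \sum_(1 <= n < N.+1) n%:R^-1.
Proof.
apply: contrapT => h; apply: (@dvg_harmonic R); apply: nondecreasing_is_cvgn.
  by apply: nondecreasing_series => n _ _; rewrite invr_ge0 ler0n.
exists K => _ [N _ <-]; rewrite leNgt; apply/negP => KN; apply: h.
by exists N; rewrite big_add1 ltW.
Qed.

Section cesaro.
Context {R : realType} {X : completeNormedModType R[i]}.
Variable S : {linear X -> X}.

(** A polynomial B_n in S with (I - S) B_n = I - A_n, A_n being the n-th average:
    the k-th inner sum divides I - S^k by I - S. *)
Definition cesaro_potential (n : nat) (x : X) : X :=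
  n%:R^-1 *: \sum_(1 <= k < n.+1) \sum_(0 <= i < k) iter i S x.

Lemma iter_linearB n x y : iter n S (x - y) = iter n S x - iter n S y.
Proof. by elim: n => //= n ->; rewrite linearB. Qed.

Lemma sum_iter_sub n x :
  \sum_(0 <= i < n) iter i S (x - S x) = x - iter n S x.
Proof.
elim: n => [|n IH]; first by rewrite big_nil subrr.
by rewrite big_nat_recr //= IH iter_linearB -iterSr addrA subrK.
Qed.

Lemma iter_commute (A : X -> X) n x :
  (forall x, A (S x) = S (A x)) -> A (iter n S x) = iter n S (A x).
Proof. by move=> AS; elim: n => //= n IH; rewrite AS IH. Qed.

Lemma ergodic_average_commute (A : {linear X -> X}) n x :
  (forall x, A (S x) = S (A x)) ->
  A (ergodic_average S n x) = ergodic_average S n (A x).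
Proof.
move=> AS; rewrite /ergodic_average linearZ linear_sum; congr (_ *: _).
by apply: eq_bigr => k _; exact: iter_commute.
Qed.

Lemma cesaro_potential_commute (A : {linear X -> X}) n x :
  (forall x, A (S x) = S (A x)) ->
  A (cesaro_potential n x) = cesaro_potential n (A x).
Proof.
move=> AS; rewrite /cesaro_potential linearZ linear_sum; congr (_ *: _).
apply: eq_bigr => k _; rewrite linear_sum.
by apply: eq_bigr => i _; exact: iter_commute.
Qed.

Lemma cesaro_potential_subE n x : (0 < n)%N ->
  cesaro_potential n x - S (cesaro_potential n x) = x - ergodic_average S n x.
Proof.
move=> n0; rewrite cesaro_potential_commute //.
rewrite /cesaro_potential /ergodic_average -scalerBr -sumrB.
under eq_bigr => k _.
  rewrite -sumrB; under eq_bigr do rewrite -iter_linearB.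
  rewrite sum_iter_sub; over.
rewrite sumrB sumr_const_nat subn1 /= scalerBr -[x *+ n]scaler_nat scalerA mulVf ?scale1r //.
by rewrite pnatr_eq0 -lt0n.
Qed.

Lemma ergodic_averageB n x y :
  ergodic_average S n (x - y) = ergodic_average S n x - ergodic_average S n y.
Proof.
rewrite /ergodic_average -scalerBr -sumrB; congr (_ *: _).
by apply: eq_bigr => k _; exact: iter_linearB.
Qed.

Lemma ergodic_average_sub n x :
  ergodic_average S n (x - S x) = n%:R^-1 *: (S x - iter n.+1 S x).
Proof.
rewrite /ergodic_average; congr (_ *: _).
rewrite big_add1 succnK; under eq_bigr do rewrite iterSr.
by rewrite linearB /= sum_iter_sub -iterSr.
Qed.

Lemma ergodic_average_fixed n x : (0 < n)%N -> S x = x ->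
  ergodic_average S n x = x.
Proof.
move=> n0 Sx; rewrite /ergodic_average.
have Sk k : iter k S x = x by elim: k => //= k ->.
under eq_bigr do rewrite Sk.
rewrite sumr_const_nat subn1 /= -[x *+ n]scaler_nat scalerA mulVf ?scale1r //.
by rewrite pnatr_eq0 -lt0n.
Qed.

Variable M : R.
Hypothesis S_pb : forall n x, nrm (iter n S x) <= M * nrm x.

Lemma nrm_ergodic_average_sub n x :
  nrm (ergodic_average S n (x - S x)) <= n%:R^-1 * (2 * M * nrm x).
Proof.
rewrite ergodic_average_sub nrmZ_nat_inv ler_wpM2l ?invr_ge0 ?ler0n //.
rewrite (le_trans (ler_nrmB _ _)) //.
have := S_pb 1 x; have := S_pb n.+1 x => /=; lra.
Qed.

Lemma nrm_sub_iter n x : nrm (x - iter n S x) <= n%:R * (M * nrm (x - S x)).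
Proof.
rewrite -sum_iter_sub (le_trans (nrm_sum_le _ _ _)) //.
rewrite (le_trans (ler_sum _ (fun i _ => S_pb i (x - S x)))) //.
by rewrite sumr_const_nat subn0 mulr_natl.
Qed.

(** With d = |y - S y| one has |y - S^n y| <= n M d, so that dividing by n and
    summing up to N shows that (1 + ... + 1/N) y differs from the N-th partial
    sum by at most N M d.  It remains to choose N for which the harmonic sum
    is at least K + 1. *)
Lemma bounded_below_of_log_series (K : R) : exists2 C : R, 0 <= C &
  forall y,
    (forall N, nrm (\sum_(1 <= n < N.+1) n%:R^-1 *: iter n S y) <= K * nrm y) ->
    nrm y <= C * nrm (y - S y).
Proof.
have [N hN] := harmonic_unbounded (K + 1).
exists (N%:R * `|M|); first by rewrite mulr_ge0.
move=> y yK; set d := nrm (y - S y).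
pose h : R := \sum_(1 <= n < N.+1) n%:R^-1.
have h0 : 0 <= h by apply: sumr_ge0 => n _; rewrite invr_ge0 ler0n.
have hC : h%:C%C *: y = \sum_(1 <= n < N.+1) n%:R^-1 *: y.
  rewrite -scaler_suml; congr (_ *: _); rewrite rmorph_sum; apply: eq_bigr => n _.
  by rewrite fmorphV rmorph_nat.
have hy : h * nrm y <= K * nrm y + N%:R * (`|M| * d).
  rewrite -[h]ger0_norm // -nrmZ_real hC.
  have -> : \sum_(1 <= n < N.+1) n%:R^-1 *: y =
      \sum_(1 <= n < N.+1) n%:R^-1 *: iter n S y +
      \sum_(1 <= n < N.+1) n%:R^-1 *: (y - iter n S y).
    by rewrite -big_split; apply: eq_bigr => n _; rewrite /= -scalerDr addrC subrK.
  rewrite (le_trans (ler_nrmD _ _)) // lerD // (le_trans (nrm_sum_le _ _ _)) //.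
  rewrite big_add1 succnK mulr_natl -[X in _ <= _ *+ X]subn0 -sumr_const_nat.
  apply: ler_sum => n _; rewrite nrmZ_nat_inv ler_pdivrMl ?ltr0n //.
  rewrite (le_trans (nrm_sub_iter _ _)) // ler_wpM2l // ler_wpM2r ?nrm_ge0 //.
  exact: ler_norm.
have := ler_wpM2r (nrm_ge0 y) hN; rewrite -/h; move: hy; rewrite mulrA; lra.
Qed.

End cesaro.

(** * Limits of averages, and solving the coboundary equation *)
Lemma zmod_subACA (V : zmodType) (a b c d : V) :
  (a - b) - (c - d) = (a - c) - (b - d).
Proof. by rewrite !opprB addrACA [RHS]addrACA [- b + _]addrC. Qed.

Section mean_ergodic_limit.
Context {R : realType} {X : completeNormedModType R[i]}.
Variables (S : {linear X -> X}) (M : R).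
Hypothesis S_pb : forall n x, nrm (iter n S x) <= M * nrm x.

Lemma bounded_operator_pb : bounded_operator S.
Proof. by apply: (@bounded_operatorI _ _ S M) => x; exact: (S_pb 1). Qed.

Lemma ergodic_average_sub_cvg0 x :
  ergodic_average S n (x - S x) @[n --> \oo] --> (0 : X).
Proof.
apply: (@cvg_nrm_inv _ _ _ _ (2 * M * nrm x)) => n _.
by rewrite subr0; exact: nrm_ergodic_average_sub.
Qed.

Variable P : X -> X.
Hypothesis P_bounded : bounded_operator P.
Hypothesis P_limit : forall x, ergodic_average S n x @[n --> \oo] --> P x.

(** The limit belongs to the bicommutant of S; this is what makes the
    projections attached to different eigenvalues of one operator commute. *)
Lemma ergodic_limit_commute (A : X -> X) x : bounded_operator A ->
  (forall y, A (S y) = S (A y)) -> A (P x) = P (A x).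
Proof.
move=> Ab AS; have AP := bounded_cvg Ab (@P_limit x).
have [F FE _] := bounded_operatorP Ab; rewrite FE in AS AP *.
apply: cvg_nrm_unique AP _; under eq_fun do rewrite ergodic_average_commute //.
exact: (@P_limit (F x)).
Qed.

Lemma ergodic_limit_fixed x : S (P x) = P x.
Proof.
have [F FE _] := bounded_operatorP P_bounded.
rewrite (ergodic_limit_commute _ bounded_operator_pb) //.
apply/esym/eqP; rewrite -subr_eq0 FE -linearB -FE; apply/eqP.
exact: cvg_nrm_unique (@P_limit _) (ergodic_average_sub_cvg0 x).
Qed.

Lemma ergodic_limit_idem x : P (P x) = P x.
Proof.
apply: cvg_nrm_unique (@P_limit (P x)) _; apply: (@cvg_nrm_inv _ _ _ _ 0) => n n0.
by rewrite ergodic_average_fixed ?ergodic_limit_fixed // subrr nrm0 mulr0.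
Qed.

Lemma cesaro_potential_cvg x :
  cesaro_potential S n x - S (cesaro_potential S n x) @[n --> \oo] --> x - P x.
Proof.
apply/cvg_nrmP => e e0; have /cvg_nrmP /(_ e e0)[N xN] := @P_limit x.
exists N.+1 => n Nn; rewrite cesaro_potential_subE ?(leq_trans _ Nn) //.
by rewrite opprB addrC addrA subrK nrm_distrC; apply: xN; exact: ltnW.
Qed.

End mean_ergodic_limit.

Section coboundary_equation.
Context {R : realType} {X : completeNormedModType R[i]}.
Variables (S : {linear X -> X}) (M : R).
Hypothesis S_pb : forall n x, nrm (iter n S x) <= M * nrm x.
Variable E : {linear X -> X}.
Hypothesis E_bounded : bounded_operator E.
Hypothesis E_commute : forall x, E (S x) = S (E x).
Hypothesis E_idem : forall x, E (E x) = E x.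

(** Below, B_n = [cesaro_potential S n].  The vectors B_n E x solve the equation
    up to A_n E x, which tends to 0 because I - S is bounded below on the range
    of E and (I - S) A_n = O(1/n).  The lower bound also turns the
    convergence of (I - S) B_n E x into that of B_n E x. *)
Lemma coboundary_solvable (C : R) : 0 <= C ->
  (forall y, nrm (E y) <= C * nrm (E y - S (E y))) ->
  forall x, exists y, E y = y /\ y - S y = E x.
Proof.
move=> C0 below x; set z := E x; have Ez : E z = z by exact: E_idem.
pose y n := cesaro_potential S n z.
have Ey n : E (y n) = y n by rewrite cesaro_potential_commute // Ez.
have ySy n : (0 < n)%N -> y n - S (y n) = z - ergodic_average S n z.
  exact: cesaro_potential_subE.
have Az n : nrm (ergodic_average S n z) <= n%:R^-1 * (C * (2 * M * nrm z)).
  have EA : E (ergodic_average S n z) = ergodic_average S n z.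
    by rewrite ergodic_average_commute // Ez.
  rewrite -{1}EA (le_trans (below _)) // EA mulrCA ler_wpM2l //.
  rewrite ergodic_average_commute // -ergodic_averageB.
  exact: nrm_ergodic_average_sub.
have /cvg_nrmP Az0 : ergodic_average S n z @[n --> \oo] --> (0 : X).
  by apply: cvg_nrm_inv => n _; rewrite subr0; exact: Az.
have ydist n m : (0 < n)%N -> (0 < m)%N -> nrm (y n - y m) <=
    C * (nrm (ergodic_average S n z) + nrm (ergodic_average S m z)).
  move=> n0 m0; have Eyy : E (y n - y m) = y n - y m by rewrite linearB !Ey.
  rewrite -Eyy (le_trans (below _)) // ler_wpM2l // Eyy.
  rewrite linearB /= zmod_subACA !ySy // zmod_subACA subrr sub0r nrmN.
  exact: ler_nrmB.
have [|l yl] := @cauchy_nrm_cvg _ _ y.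
  move=> e e0; have /Az0[N AN] : 0 < e / (2 * C + 1).
    by rewrite divr_gt0 // ltr_wpDl // mulr_ge0.
  exists N.+1 => n Nn; rewrite (le_lt_trans (ydist _ _ _ _)) ?(leq_trans _ Nn) //.
  have := AN n (ltnW Nn); have := AN _ (leqnSn N); rewrite !subr0.
  set e' := e / _ => h1 h2; have -> : e = (2 * C + 1) * e'.
    by rewrite mulrC divfK // gt_eqF // ltr_wpDl // mulr_ge0.
  have e'0 : 0 < e' by exact: le_lt_trans (nrm_ge0 _) h1.
  have : C * (nrm (ergodic_average S n z) + nrm (ergodic_average S N.+1 z)) <=
      C * (e' + e') by rewrite ler_wpM2l // lerD // ltW.
  lra.
have S_bounded := bounded_operator_pb S_pb.
exists l; split.
  have := bounded_cvg E_bounded yl; under eq_fun do rewrite Ey.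
  by move=> h; exact: cvg_nrm_unique h yl.
have I_S := bounded_sub (bounded_id (X := X)) S_bounded.
apply: cvg_nrm_unique (bounded_cvg I_S yl) _.
apply/cvg_nrmP => e /Az0[N AN]; exists N.+1 => n Nn.
rewrite [(_ \- _) _]ySy ?(leq_trans _ Nn) // addrAC subrr add0r nrmN.
by rewrite -[X in nrm X]subr0; apply: AN; exact: ltnW.
Qed.

(** Uniqueness of the solution in the range of E makes it depend linearly on
    the right-hand side and commute with S. *)
Lemma coboundary_operator (C : R) : 0 <= C ->
  (forall y, nrm (E y) <= C * nrm (E y - S (E y))) ->
  exists V : X -> X, [/\ bounded_operator V, forall x, V (S x) = S (V x) &
    forall x, V x - S (V x) = E x].
Proof.
move=> C0 below; have [V VP] := choice (coboundary_solvable C0 below).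
have EV x : E (V x) = V x by have [] := VP x.
have VS x : V x - S (V x) = E x by have [] := VP x.
have inj x y : E x = x -> E y = y -> x - S x = y - S y -> x = y.
  move=> Ex Ey xy; apply/eqP; rewrite -subr_eq0; apply/eqP/nrm_eq0/le_anti.
  have Exy : E (x - y) = x - y by rewrite linearB Ex Ey.
  rewrite nrm_ge0 andbT -Exy (le_trans (below _)) // Exy linearB /=.
  by rewrite zmod_subACA xy subrr nrm0 mulr0.
exists V; split=> // [|x].
  split.
    move=> a x y; apply: inj; rewrite ?linearP ?EV //= VS !linearP -!VS.
    by rewrite scalerBr scalerN addrACA.
  have [F FE [c c0 Ec]] := bounded_operatorP E_bounded.
  exists (C * c) => x; rewrite -[leLHS]/(nrm _) -EV (le_trans (below _)) //.
  by rewrite EV VS -mulrA ler_wpM2l //= FE Ec.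
apply: inj; rewrite ?EV ?E_commute ?EV // VS -linearB VS.
exact: E_commute.
Qed.

End coboundary_equation.

(** * Rotations of a power-bounded operator *)
Section circle.
Context {R : realType}.
Implicit Types a b : R[i].

Lemma unit_circle_mulCconj a : unit_circle a -> a * a^* = 1.
Proof. by move=> a1; rewrite -normCK a1 expr1n. Qed.

Lemma unit_circle_conj a : unit_circle a -> unit_circle a^*.
Proof. by move=> a1; rewrite /unit_circle /= norm_conjC. Qed.

Context {X : completeNormedModType R[i]}.

Lemma iter_scale (T : {linear X -> X}) a n x :
  iter n (a \*: T) x = a ^+ n *: iter n T x.
Proof.
elim: n => [|n IH]; first by rewrite scale1r.
by rewrite iterS IH /= linearZ scalerA exprS.
Qed.

Lemma rotation_pb (T : {linear X -> X}) (M : R) a : unit_circle a ->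
  (forall n x, nrm (iter n T x) <= M * nrm x) ->
  forall n x, nrm (iter n (a \*: T) x) <= M * nrm x.
Proof.
move=> a1 TM n x; rewrite iter_scale nrmZ_circle //.
by rewrite /unit_circle /= normrX a1 expr1n.
Qed.

Lemma bounded_bigsum (I : Type) (s : seq I) (f : I -> X -> X) :
  (forall i, bounded_operator (f i)) ->
  bounded_operator (fun x => \sum_(i <- s) f i x).
Proof.
move=> fb; elim: s => [|i s IH].
  by under eq_fun do rewrite big_nil; exact: bounded_0.
by under eq_fun do rewrite big_cons; exact: bounded_add.
Qed.

End circle.

Section rotations.
Context {R : realType} {X : completeNormedModType R[i]}.
Variables (T : {linear X -> X}) (M : R) (I : Type) (lambda_ : I -> R[i]).
Hypothesis M_gt0 : 0 < M.
Hypothesis T_pb : forall n x, nrm (iter n T x) <= M * nrm x.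
Hypothesis lambda_T : forall j, unit_circle (lambda_ j).
Hypothesis T_me : forall j, mean_ergodic ((lambda_ j)^* \*: T).

(** D = F + (I - lambda T) W, where the range of F is fixed by lambda T: the
    averages of lambda T leave F unchanged and send the second term to 0 in
    norm.  The last clause serves the spectral inclusion: for D = I it makes W an
    inverse of I - lambda T when lambda is the inverse of no lambda_j. *)
Definition eigen_coboundary (lambda : R[i]) (D : X -> X) : Prop :=
  exists F W : X -> X,
    [/\ bounded_operator F, bounded_operator W, forall x, W (T x) = T (W x),
        forall x, lambda *: T (F x) = F x &
        forall x, D x = F x + (W x - lambda *: T (W x))] /\
    ((forall j, lambda * lambda_ j <> 1) -> forall x, F x = 0).

Lemma eigen_coboundaryD lambda D D' :
  eigen_coboundary lambda D -> eigen_coboundary lambda D' ->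
  eigen_coboundary lambda (D \+ D').
Proof.
move=> [F [W [[Fb Wb WT TF DE] F0]]] [F' [W' [[F'b W'b W'T TF' D'E] F'0]]].
exists (F \+ F'), (W \+ W'); split; last first.
  by move=> reg x /=; rewrite F0 // F'0 // addr0.
split=> [||x|x|x] /=; try exact: bounded_add.
- by rewrite WT W'T linearD.
- by rewrite linearD scalerDr TF TF'.
- by rewrite DE D'E linearD scalerDr opprD addrACA [W x + _ + _]addrACA.
Qed.

Lemma eigen_coboundary_coboundary lambda V : bounded_operator V ->
  (forall x, V (T x) = T (V x)) ->
  eigen_coboundary lambda (fun x => V x - lambda *: T (V x)).
Proof.
move=> Vb VT; exists (fun=> 0), V; do 2?split=> //; first exact: bounded_0.
- by rewrite linear0 scaler0.
- by move=> x; rewrite add0r.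
Qed.

(** On eigenvectors lambda T acts as the scalar lambda * lambda_j: if it is 1 the
    operator goes to the fixed part, otherwise I - lambda T can be divided
    out. *)
Lemma eigen_coboundary_eigen lambda j D : bounded_operator D ->
  (forall x, D (T x) = T (D x)) -> (forall x, T (D x) = lambda_ j *: D x) ->
  eigen_coboundary lambda D.
Proof.
move=> Db DT TD; have [lj|lj] := eqVneq (lambda * lambda_ j) 1.
  exists D, (fun=> 0); split; last by move=> /(_ j).
  split=> // [|x|x|x]; first exact: bounded_0.
  - by rewrite linear0.
  - by rewrite TD scalerA lj scale1r.
  - by rewrite linear0 scaler0 subr0 addr0.
have lj0 : 1 - lambda * lambda_ j != 0 by rewrite subr_eq0 eq_sym.
exists (fun=> 0), ((1 - lambda * lambda_ j)^-1 \*: D); split=> //.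
split=> [||x|x|x] /=.
- exact: bounded_0.
- exact: bounded_scale.
- by rewrite DT [RHS]linearZ.
- by rewrite linear0 scaler0.
- rewrite [T (_ *: _)]linearZ /= TD !scalerA -scalerBl add0r -[LHS]scale1r.
  by congr (_ *: _); field.
Qed.

(** From I = F + (I - S) W and A_n F = F, with S = lambda T, the difference
    A_n - F equals A_n (I - S) W, and A_n (I - S) = (S - S^(n+1)) / n. *)
Lemma eigen_coboundary_id_uniformly_ergodic lambda : unit_circle lambda ->
  eigen_coboundary lambda idfun -> uniformly_ergodic (lambda \*: T).
Proof.
move=> l1 [F [W [[Fb Wb WT TF idE] _]]]; exists F => //.
have S_pb := rotation_pb l1 T_pb.
have [w wE [C C0 wC]] := bounded_operatorP Wb.
have WE x : W x - lambda *: T (W x) = x - F x.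
  by rewrite [X in X - F x](idE x : x = _) addrAC subrr add0r.
have AF n x : (0 < n)%N -> nrm (ergodic_average (lambda \*: T) n x - F x) <=
    n%:R^-1 * (2 * M * C) * nrm x.
  move=> n0.
  rewrite -{1}(ergodic_average_fixed (S := lambda \*: T) n0 (TF x)).
  rewrite -ergodic_averageB -WE.
  rewrite (le_trans (nrm_ergodic_average_sub S_pb _ _)) // -[leRHS]mulrA.
  rewrite ler_wpM2l ?invr_ge0 ?ler0n // -[leRHS]mulrA ler_wpM2l ?mulr_ge0 ?(ltW M_gt0) //.
  by rewrite wE.
have op0 n : (0 < n)%N -> 0 <= opnorm (ergodic_average (lambda \*: T) n \- F)
     <= n%:R^-1 * (2 * M * C).
  move=> n0; apply/andP; split.
    apply: (@opnorm_ge0 _ _ _ (n%:R^-1 * (2 * M * C))) => x; exact: AF.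
  apply: opnorm_le => [|x]; last exact: AF.
  by rewrite !mulr_ge0 ?invr_ge0 ?ler0n ?(ltW M_gt0) ?(ltW C0).
apply: (@squeeze_cvgr _ _ _ _ (fun=> 0) (fun n => n%:R^-1 * (2 * M * C))).
- by exists 1%N => // n; exact: op0.
- exact: cvg_cst.
- rewrite -[X in _ --> X](mul0r (2 * M * C)); apply: cvgMl.
  rewrite -(cvg_shiftS (fun n : nat => n%:R^-1 : R)); exact: cvg_harmonic.
Qed.

Lemma eigen_coboundary_id_invertible lambda : unit_circle lambda ->
  (forall j, lambda * lambda_ j <> 1) ->
  eigen_coboundary lambda idfun ->
  invertible_operator (lambda^* \*: idfun \- T).
Proof.
move=> l1 reg [F [W [[_ Wb WT _ idE] /(_ reg) F0]]].
exists (lambda \*: W); first exact: bounded_scale.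
have WE x : W x - lambda *: T (W x) = x by rewrite [RHS]idE F0 add0r.
have ll := unit_circle_mulCconj l1.
have [w wE _] := bounded_operatorP Wb.
split=> x /=.
  by rewrite wE linearB [w (_ *: _)]linearZ /= -wE WT scalerBr scalerA ll scale1r WE.
by rewrite [T _]linearZ /= scalerA mulrC ll scale1r WE.
Qed.

Lemma eigen_coboundary_ext lambda D D' : D =1 D' ->
  eigen_coboundary lambda D -> eigen_coboundary lambda D'.
Proof. by move=> /funext ->. Qed.

(** The properties of the product E of the I - P_j, j in r, with P_j the ergodic
    projection of conj(lambda_j) T.  Commutation is stated with everything
    that commutes with T, because this passes to products and yields
    idempotency.  The last clause is the form in which the decomposition of
    I - E into operators with values in the eigenspaces is used. *)
Definition ergodic_complement (r : seq I) (E : X -> X) : Prop :=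
  [/\ bounded_operator E,
      forall A : X -> X, bounded_operator A -> (forall x, A (T x) = T (A x)) ->
        forall x, E (A x) = A (E x),
      forall x, E (E x) = E x,
      forall x,
        closure (range (\big[comp/idfun]_(j <- r) (lambda_ j \*: idfun \- T)))
          (E x) &
      forall lambda, eigen_coboundary lambda E -> eigen_coboundary lambda idfun].

Let T_bounded : bounded_operator T := bounded_operator_pb T_pb.

Lemma annihilator_bounded (r : seq I) :
  let Q := \big[comp/idfun]_(j <- r) (lambda_ j \*: idfun \- T) in
  bounded_operator Q /\ forall x, Q (T x) = T (Q x).
Proof.
elim: r => [|j r [Qb QT]] /=.
  by rewrite big_nil; split=> //; exact: bounded_id.
rewrite big_cons; split=> [|x].
  apply: bounded_comp => //; apply: bounded_sub T_bounded.
  by apply: bounded_scale; exact: bounded_id.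
by rewrite /= QT linearB [T (_ *: _)]linearZ.
Qed.

(** The new operator is (I - P) E.  That it maps into the closure of the range of
    (lambda_j - T) Q, where Q is the product for r, is seen by approximation:
    E x is close to some Q z, and (I - P) Q z is the limit of
    (I - S) B_n Q z = (lambda_j - T) Q (conj(lambda_j) B_n z).  The operator that
    has been split off is P E, whose range consists of eigenvectors. *)
Lemma ergodic_complement_cons j r E : ergodic_complement r E ->
  exists E', ergodic_complement (j :: r) E'.
Proof.
move=> [Eb Ecomm Eidem Ecl Eec].
pose S : {linear X -> X} := (lambda_ j)^* \*: T.
have l1 := unit_circle_conj (lambda_T j).
have ll := unit_circle_mulCconj (lambda_T j).
have [P Pb PL] := T_me j.
have S_pb : forall n x, nrm (iter n S x) <= M * nrm x by exact: rotation_pb.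
have SP := ergodic_limit_fixed S_pb Pb PL.
have PP := ergodic_limit_idem S_pb Pb PL.
have TP x : T (P x) = lambda_ j *: P x.
  by rewrite -[in RHS]SP /= scalerA ll scale1r.
have Pcomm A : bounded_operator A -> (forall x, A (T x) = T (A x)) ->
    forall x, A (P x) = P (A x).
  move=> Ab AT x; apply: (ergodic_limit_commute PL) => // y.
  have [F FE _] := bounded_operatorP Ab.
  by rewrite /= FE [LHS]linearZ /= -FE AT.
have TT x : P (T x) = T (P x) by rewrite Pcomm.
have ET x : E (T x) = T (E x) by apply: Ecomm.
have EP x : E (P x) = P (E x) by apply: Pcomm.
have [p pE _] := bounded_operatorP Pb.
have [e eE _] := bounded_operatorP Eb.
have PEb : bounded_operator (P \o E) by exact: bounded_comp.
exists (E \- (P \o E)); split.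
- exact: bounded_sub.
- move=> A Ab AT x /=; have [F FE _] := bounded_operatorP Ab.
  by rewrite Ecomm // -Pcomm // FE linearB.
- move=> x /=.
  have -> : E (E x - P (E x)) = E x - P (E x).
    by rewrite eE linearB -eE EP !Eidem.
  have -> : P (E x - P (E x)) = 0 by rewrite pE linearB -pE PP subrr.
  by rewrite subr0.
- move=> x /=; have := Ecl x; move: (E x) => y {x}.
  rewrite big_cons; set Q := \big[_/_]_(_ <- _) _ => /closure_nrmP yQ.
  have [Qb QT] := annihilator_bounded r; rewrite -/Q in Qb QT.
  have [q qE _] := bounded_operatorP Qb.
  have [D DE [d d0 Dd]] := bounded_operatorP (bounded_sub (bounded_id (X := X)) Pb).
  apply/closure_nrmP => eps eps0.
  have [|_ [z _ <-] yz] := yQ (eps / 2 / d); first by rewrite !divr_gt0.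
  have /cvg_nrmP := @cesaro_potential_cvg _ _ S P PL (Q z).
  move=> /(_ (eps / 2)) [|n /(_ n (leqnn n))]; first by rewrite divr_gt0.
  set b := cesaro_potential S n z.
  have Qb' : cesaro_potential S n (Q z) = Q b.
    rewrite /b qE cesaro_potential_commute // -qE => w.
    by rewrite /= qE [LHS]linearZ /= -qE QT.
  rewrite Qb' => bz.
  exists (Q b - S (Q b)).
    exists ((lambda_ j)^* *: b) => //=.
    by rewrite qE [q _]linearZ /= [T _]linearZ scalerA ll scale1r.
  rewrite (le_lt_trans (nrm_triangle _ (Q z - P (Q z)) _)) //.
  rewrite (_ : eps = eps / 2 + eps / 2); last by field.
  rewrite ltrD //; last by rewrite nrm_distrC.
  rewrite -[y - P y]/((idfun \- P) y) -[Q z - _]/((idfun \- P) (Q z)) DE -linearB.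
  by rewrite (le_lt_trans (Dd _)) // mulrC -ltr_pdivlMr.
- move=> lambda E'ec; apply: Eec.
  apply: (@eigen_coboundary_ext lambda ((E \- (P \o E)) \+ (P \o E))).
    by move=> x /=; rewrite subrK.
  apply: eigen_coboundaryD => //; apply: (@eigen_coboundary_eigen _ j) => //.
  + by move=> x /=; rewrite ET TT.
  + by move=> x /=; rewrite TP.
Qed.

Lemma ergodic_complement_exists r : exists E, ergodic_complement r E.
Proof.
elim: r => [|j r [E /(ergodic_complement_cons j)]] //.
exists idfun; split=> // [|x]; first exact: bounded_id.
by rewrite big_nil; apply: subset_closure; exists x.
Qed.

(** The convergence of the series is used only to bound its partial sums on the
    range of E; composing with E makes them operators defined on all of X, to
    which the uniform boundedness principle applies. *)
Lemma rotation_coboundary_id r lambda : unit_circle lambda ->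
  (forall x,
     closure (range (\big[comp/idfun]_(j <- r) (lambda_ j \*: idfun \- T))) x ->
     cvgn (fun N : nat =>
       \sum_(1 <= n < N.+1) (lambda ^+ n / n%:R) *: iter n T x)) ->
  eigen_coboundary lambda idfun.
Proof.
move=> l1 Tcvg; have [E [Eb Ecomm Eidem Ecl]] := ergodic_complement_exists r.
apply; pose S : {linear X -> X} := lambda \*: T.
have S_pb : forall n x, nrm (iter n S x) <= M * nrm x by exact: rotation_pb.
have Sb := bounded_operator_pb S_pb.
pose L N x := \sum_(1 <= n < N.+1) n%:R^-1 *: iter n S (E x).
have Lb N : bounded_operator (L N).
  apply: bounded_bigsum => n; apply: (@bounded_scale _ _ _ (iter n S \o E)).
  by apply: bounded_comp => //; exact: bounded_iter.
have [|K LK] := uniform_boundedness Lb.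
  move=> x; have /cvgn_nrm_bounded[K xK] := Tcvg (E x) (Ecl x).
  exists K => N; rewrite (le_trans _ (xK N)) // le_eqVlt; apply/orP; left.
  apply/eqP; congr nrm; apply: eq_bigr => n _.
  by rewrite iter_scale scalerA mulrC.
have [C C0 below] := bounded_below_of_log_series S_pb K.
have [e eE _] := bounded_operatorP Eb; rewrite {}eE in Eb Ecomm Eidem Ecl L Lb LK *.
have ES x : e (S x) = S (e x) by rewrite /= [LHS]linearZ /= Ecomm.
have [|V [Vb VS VE]] := @coboundary_operator _ _ S M S_pb e Eb ES Eidem C C0.
  by move=> y; apply: below => N; rewrite -{1}Eidem; exact: LK.
have VT x : V (T x) = T (V x).
  have TS y : T y = lambda^* *: S y.
    by rewrite /= scalerA mulrC unit_circle_mulCconj // scale1r.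
  have [v vE _] := bounded_operatorP Vb.
  by rewrite TS vE [LHS]linearZ /= -vE VS -TS.
apply: (@eigen_coboundary_ext lambda (fun x => V x - lambda *: T (V x))) => //.
exact: eigen_coboundary_coboundary.
Qed.

End rotations.

Theorem theorem4p7 (R : realType) (X : completeNormedModType R[i])
    (T : {linear X -> X}) (k : nat) (lambda_ : 'I_k -> R[i])
    (k_gt0 : (0 < k)%N)
    (T_pb : power_bounded T)
    (lambda_T : forall j, unit_circle (lambda_ j))
    (T_me : forall j, mean_ergodic ((lambda_ j)^* \*: T))
    (T_cvg : forall x,
       closure (range (\big[comp/idfun]_(j < k) (lambda_ j \*: idfun \- T))) x ->
       forall lambda : R[i], unit_circle lambda ->
       cvgn (fun N : nat =>
         \sum_(1 <= n < N.+1) (lambda ^+ n / n%:R) *: iter n T x)) :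
  rotationally_uniformly_ergodic T /\
  spectrum T `&` @unit_circle R `<=` range lambda_.
Proof.
have [M M_gt0 TM] := power_boundedP T_pb.
have key lambda : unit_circle lambda -> eigen_coboundary T lambda_ lambda idfun.
  move=> l1; apply: (rotation_coboundary_id TM lambda_T T_me (r := index_enum _) l1) => x Qx.
  exact: T_cvg Qx _ l1.
split=> [lambda l1|mu [mu_spec mu1]].
  exact: eigen_coboundary_id_uniformly_ergodic M_gt0 TM _ l1 (key _ l1).
apply: contrapT => mu_range; apply: mu_spec.
have l1 := unit_circle_conj mu1; rewrite -[mu]conjCK.
apply: eigen_coboundary_id_invertible l1 _ (key _ l1) => j lj; apply: mu_range.
exists j => //; rewrite -[lambda_ j]mul1r -(unit_circle_mulCconj mu1).
by rewrite -mulrA lj mulr1.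
Qed.
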